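(* Let $X$ be a real Banach space with $\dim X\ge 2$. If $X$ is uniformly convex, then for every $\lambda\in(0,1)$, $$J_\lambda^\perp(X)<1.$$
   Context: For a real Banach space $X$, $S_X=\{x\in X:\|x\|=1\}$. For $x,y\in X$, $x\perp_B y$ (Birkhoff--James orthogonality) means $\|x\|\le\|x+ty\|$ for every $t\in\mathbb R$. For $\lambda\in[0,1]$, $$J_\lambda^\perp(X)=\sup\{\min\{\|\lambda x+(1-\lambda)y\|,\|\lambda x-(1-\lambda)y\|\}: x,y\in S_X,\ x\perp_B y\}.$$ *)

(* Defs.v *)
From HB Require Import structures.
From mathcomp Require Import all_boot all_order all_algebra.
From mathcomp Require Import all_classical all_reals all_analysis.

Set Implicit Arguments.
Unset Strict Implicit.
Unset Printing Implicit Defensive.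

Import Order.TTheory GRing.Theory Num.Theory.
Import numFieldNormedType.Exports.

Local Open Scope classical_set_scope.
Local Open Scope ring_scope.

(* X may be infinite-dimensional: dim X >= n means that X contains n linearly
   independent vectors. *)
Definition dim_ge (R : realType) (X : normedModType R) (n : nat) : Prop :=
  exists e : 'I_n -> X,
    forall c : 'I_n -> R, \sum_(i < n) c i *: e i = 0 -> forall i, c i = 0.

Definition unit_sphere (R : realType) (X : normedModType R) : set X :=
  [set x | `|x| = 1].

Definition BJ_orthogonal (R : realType) (X : normedModType R) (x y : X) : Prop :=
  forall t : R, `|x| <= `|x + t *: y|.

(* Clarkson's definition; equivalently, the modulus of convexity
   inf {1 - `|x + y| / 2 : x, y in the unit sphere, `|x - y| >= eps}
   is positive for every eps in (0, 2]. *)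
Definition uniformly_convex (R : realType) (X : normedModType R) : Prop :=
  forall eps : R, 0 < eps <= 2 ->
    exists2 delta : R, 0 < delta &
      forall x y : X, unit_sphere x -> unit_sphere y ->
        eps <= `|x - y| -> `|2^-1 *: (x + y)| <= 1 - delta.

(* For lambda in [0, 1] this set is bounded above by 1, so that [sup] does not
   fall back on its default value for want of an upper bound. *)
Definition J_perp (R : realType) (X : normedModType R) (lambda : R) : R :=
  sup [set r : R | exists x y : X,
    [/\ unit_sphere x, unit_sphere y, BJ_orthogonal x y &
        r = Num.min `|lambda *: x + (1 - lambda) *: y|
                    `|lambda *: x - (1 - lambda) *: y| ]].

Arguments dim_ge {R} X n.
Arguments uniformly_convex {R} X.
Arguments J_perp {R} X lambda.

(* Main.v *)
Require Import Defs.
From mathcomp Require Import all_boot all_order all_algebra.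
From mathcomp Require Import all_classical all_reals all_analysis.
From mathcomp Require Import ring lra.

Import Order.TTheory GRing.Theory Num.Theory.
Import numFieldNormedType.Exports.

Local Open Scope ring_scope.

(** Birkhoff--James orthogonality separates unit vectors: taking [t = -1] in
    its definition gives [1 = `|x| <= `|x - y|].  Uniform convexity at
    [eps = 1] therefore yields a single [delta > 0] such that the midpoint of
    every admissible pair has norm at most [1 - delta].  The point
    [lambda x + (1 - lambda) y] divides the segment from [y] to [x] at a fixed
    interior position, hence it is a convex combination of the midpoint, with
    weight [2 min(lambda, 1 - lambda)], and of one endpoint
    ([norm_convex_comb_le]).  So the first term of the minimum never exceeds
    [1 - 2 min(lambda, 1 - lambda) delta], a bound below [1] that does not
    depend on the pair, and the supremum inherits it. *)

Lemma BJ_orthogonal_le_dist {R : realType} {X : normedModType R} {x y : X} :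
  BJ_orthogonal x y -> `|x| <= `|x - y|.
Proof. by move=> /(_ (-1)); rewrite scaleN1r. Qed.

(** The defect [1 - `|m|] of the midpoint [m] is passed on, up to a factor, to
    the other points of the segment: for [l <= 1/2],
    [l x + (1 - l) y = (2 l) m + (1 - 2 l) y], and the other case follows by
    exchanging [x] with [y] and [l] with [1 - l]. *)
Lemma norm_convex_comb_le {R : realType} {X : normedModType R} {x y : X}
    {l : R} :
  unit_sphere x -> unit_sphere y -> 0 <= l <= 1 ->
  `|l *: x + (1 - l) *: y| <=
    1 - 2 * Num.min l (1 - l) * (1 - `|2^-1 *: (x + y)|).
Proof.
wlog le_l : x y l / l <= 1 - l.
  move=> half x1 y1 /andP[l0 l1]; have [le_l|lt_l] := leP l (1 - l).
    by have := half x y l; rewrite min_l//; apply=> //; rewrite l0.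
  have := half y x (1 - l).
  rewrite subKr (addrC y) (addrC (_ *: y)) (min_l (ltW lt_l)).
  by apply=> //; lra.
rewrite /unit_sphere /= => x1 y1 /andP[l0 l1]; rewrite min_l//.
have -> : l *: x + (1 - l) *: y =
    (2 * l) *: (2^-1 *: (x + y)) + (1 - 2 * l) *: y.
  rewrite scalerA (_ : 2 * l * 2^-1 = l); last by field.
  by rewrite scalerDr -addrA -scalerDl; congr (_ + _ *: _); ring.
apply: (le_trans (ler_normD _ _)); rewrite !(normrZ (_ * l)) (normrZ (1 - _)) y1.
rewrite !ger0_norm; lra.
Qed.

Theorem corollary3p14 (R : realType) (X : completeNormedModType R)
    (dimX : dim_ge X 2) (ucX : uniformly_convex X)
    (lambda : R) (lambda01 : 0 < lambda < 1) :
  J_perp X lambda < 1.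
Proof.
have [|delta delta0 ucX1] := ucX 1; first by rewrite ltr01 ler1n.
have [l0 l1] := andP lambda01.
set m := Num.min lambda (1 - lambda).
have m0 : 0 < m by rewrite /m lt_min l0 subr_gt0.
rewrite /J_perp; set A := (X in sup X).
(* On the empty set [sup] takes its default value [0]. *)
have [->|/set0P A0] := eqVneq A set0; first by rewrite sup0 ltr01.
apply: (@le_lt_trans _ _ (1 - 2 * m * delta)); last first.
  by rewrite ltrBlDr ltrDl !mulr_gt0.
apply: ge_sup => // _ [x [y [x1 y1 xy ->]]].
rewrite ge_min; apply/orP; left.
apply: (le_trans (norm_convex_comb_le x1 y1 _)); first by rewrite !ltW.
have mid : `|2^-1 *: (x + y)| <= 1 - delta.
  by apply: ucX1 => //; rewrite -{1}x1; exact: BJ_orthogonal_le_dist.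
by rewrite lerD2l lerN2 ler_pM2l ?mulr_gt0//; lra.
Qed.
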